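(* Let $\mathcal{H}$ be a complex Hilbert space and let $S\in\mathcal{P}\cdot\mathcal{L}^+$ have closed range. Then there exists a positive operator $T\in\mathcal{L}(\mathcal{H})$ with closed range and $\mathcal{N}(T)=\mathcal{N}(S)$ such that $S=P_ST$. Moreover, the projection proper splitting $T=P_T-V$ of $T$ induces a proper splitting of $S$, namely $S=P_SP_T-P_SV$. In addition, the projection proper splitting of $T$ converges if and only if the proper splitting $S=P_SP_T-P_SV$ converges.
   Context: $\mathcal{P}\cdot\mathcal{L}^+$ is the set of operators in $\mathcal{L}(\mathcal{H})$ of the form $PA$ with $P$ an orthogonal projection and $A$ a bounded positive (i.e. positive semidefinite self-adjoint) operator. $P_S$, $P_T$ are the orthogonal projections onto $\mathcal{R}(S)$, $\mathcal{R}(T)$. A proper splitting of a closed range operator $A$ is a decomposition $A=U-V$ with $U,V\in\mathcal{L}(\mathcal{H})$, $\mathcal{R}(U)=\mathcal{R}(A)$ and $\mathcal{N}(U)=\mathcal{N}(A)$; it converges if $\rho(U^\dagger V)<1$, where $\rho$ is the spectral radius and $U^\dagger$ the Moore-Penrose inverse. The projection proper splitting of a closed range Hermitian $T$ is $T=P_T-V$, i.e. $V=P_T-T$. *)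

(* Defs.v *)
From HB Require Import structures.
From mathcomp Require Import all_boot all_order all_algebra.
From mathcomp Require Import sesquilinear complex.
From mathcomp Require Import boolp classical_sets functions reals.
From mathcomp Require Import topology normedtype.

Set Implicit Arguments.
Unset Strict Implicit.
Unset Printing Implicit Defensive.

Import Order.TTheory GRing.Theory Num.Theory.
Import numFieldNormedType.Exports.

Local Open Scope classical_set_scope.
Local Open Scope ring_scope.
Local Open Scope complex_scope.

(* Complex Hilbert spaces. The inner product is linear in its first argument
   and conjugate-linear in the second one. *)
HB.mixin Record CompleteNormedModule_isHilbert (R : realType) (H : Type)
    of CompleteNormedModule R[i] H := {
  hdot : {dot H for (@Num.conj R[i])} ;
  hdot_norm : forall x : H, hdot x x = `|x| ^+ 2
}.

#[short(type="hilbertType")]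
HB.structure Definition Hilbert (R : realType) :=
  { H of CompleteNormedModule R[i] H & CompleteNormedModule_isHilbert R H }.

Section Operators.
Context {R : realType} {H : hilbertType R}.
Implicit Types (A P U V X : H -> H) (M : set H) (z : R[i]).

(* Membership in L(H): the elements of L(H) are plain functions H -> H, so that
   the difference of operators is the pointwise one. *)
Definition bounded_op A : Prop := linear A /\ continuous A.

Definition ker A : set H := [set x | A x = 0].

Definition selfadjoint A : Prop := forall x y, hdot (A x) y = hdot x (A y).

Definition positive_op A : Prop :=
  [/\ bounded_op A, selfadjoint A & forall x, 0 <= hdot (A x) x].

Definition orthogonal_projection P : Prop :=
  [/\ bounded_op P, P \o P = P & selfadjoint P].

Definition in_PLplus A : Prop :=
  exists P B : H -> H,
    [/\ orthogonal_projection P, positive_op B & A = P \o B].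

(* The orthogonal projection onto M. It exists exactly when M is a closed
   subspace, and is then unique; otherwise the value is the junk value 0. *)
Definition proj_onto M : H -> H :=
  xget 0 [set P | orthogonal_projection P /\ range P = M].

(* X is a bounded solution of the four Penrose equations for A. For A in L(H)
   it is unique, and it exists exactly when the range of A is closed. *)
Definition is_MP_inverse A X : Prop :=
  bounded_op X /\
  [/\ A \o X \o A = A, X \o A \o X = X,
      selfadjoint (A \o X) & selfadjoint (X \o A)].

Definition MP_inverse A : H -> H := xget 0 (is_MP_inverse A).

Definition invertible_op A : Prop :=
  exists B : H -> H, [/\ bounded_op B, A \o B = id & B \o A = id].

Definition spectrum A : set R[i] :=
  [set z | ~ invertible_op (A - (fun x => z *: x))].

(* For A in L(H) the set below is bounded, and it is empty only for H = 0,
   where the convention sup set0 = 0 gives spectral radius 0. *)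
Definition spectral_radius A : R :=
  sup [set r : R | exists2 z, spectrum A z & `|z| = r%:C].

Definition proper_splitting A U V : Prop :=
  [/\ bounded_op U, bounded_op V, A = U - V, range U = range A & ker U = ker A].

Definition convergent_splitting U V : Prop :=
  spectral_radius (MP_inverse U \o V) < 1.

End Operators.

(* Main.v *)
Require Import Defs.
From HB Require Import structures.
From mathcomp Require Import all_boot all_order all_algebra.
From mathcomp Require Import ring lra.
From mathcomp Require Import sesquilinear complex.
From mathcomp Require Import boolp classical_sets functions reals.
From mathcomp Require Import topology normedtype.

Import Order.TTheory GRing.Theory Num.Theory.
Import numFieldNormedType.Exports.

Local Open Scope classical_set_scope.
Local Open Scope ring_scope.

(* Write S = P A with P = P_S and A >= 0. Since S maps onto the closed range of
   P, uniform boundedness gives |m| <= C |A m| for m in that range; with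
   |A m|^2 <= |A| <A m, m> the compression of A to it is coercive, hence has a
   bounded inverse D. Put X = A P D P and T = X S = (P A)^* D (P A): then
   T >= 0, P T = S, and X is a Moore-Penrose inverse of U = P_S P_T. As U has the same
   kernel as P_T, its Moore-Penrose inverse satisfies U^+ U = P_T, so that
   U^+ P_S V = U^+ U V = P_T V = P_T^+ V: the two splittings have the same
   iteration operator. *)

(** * The Hilbert space viewed as a real inner product space *)

Section RealStructure.
Context {R : realType} {H : hilbertType R}.
Implicit Types (x y z : H) (r s : R).
Local Notation "r %:C" := (real_complex R r).

(** Norm and inner product take values in [R[i]], whose order is only partial; their real parts
    bring all estimates into the ordered field [R]. *)
Definition nrm x : R := complex.Re `|x|.
Definition rdot x y : R := complex.Re (hdot x y).
Definition rscale r x : H := r%:C *: x.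

Lemma normE x : `|x| = (nrm x)%:C.
Proof. by rewrite /nrm RRe_real // ger0_real. Qed.

Lemma nrm_ge0 x : 0 <= nrm x.
Proof. by rewrite -ler0c -normE. Qed.

Lemma nrmD x y : nrm (x + y) <= nrm x + nrm y.
Proof. by rewrite -lecR rmorphD /= -!normE ler_normD. Qed.

Lemma nrmN x : nrm (- x) = nrm x.
Proof. by rewrite /nrm normrN. Qed.

Lemma nrm_dist x y : nrm (x - y) = nrm (y - x).
Proof. by rewrite -nrmN opprB. Qed.

Lemma nrm0_eq0 x : nrm x = 0 -> x = 0.
Proof. by move=> x0; apply/normr0_eq0; rewrite normE x0. Qed.

Lemma nrm0 : nrm 0 = 0.
Proof. by rewrite /nrm normr0. Qed.

Lemma nrmZ r x : nrm (rscale r x) = `|r| * nrm x.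
Proof.
apply: complexI; rewrite rmorphM /= -!normE normrZ; congr (_ * _).
by rewrite normc_def /= expr0n addr0 sqrtr_sqr.
Qed.

Lemma hdotDl x y z : hdot (x + y) z = hdot x z + hdot y z.
Proof. exact: linearDl. Qed.

Lemma hdotBl x y z : hdot (x - y) z = hdot x z - hdot y z.
Proof. exact: linearBl. Qed.

Lemma hdotZl (c : R[i]) x z : hdot (c *: x) z = c * hdot x z.
Proof. exact: linearZl_LR. Qed.

Lemma hdotC x y : hdot x y = Num.conj (hdot y x).
Proof. by rewrite hermC expr0 mul1r. Qed.

Lemma hdotDr x y z : hdot z (x + y) = hdot z x + hdot z y.
Proof. exact: linearDr. Qed.

Lemma hdotBr x y z : hdot z (x - y) = hdot z x - hdot z y.
Proof. exact: linearBr. Qed.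

Lemma hdotZr (c : R[i]) x z : hdot z (c *: x) = Num.conj c * hdot z x.
Proof. exact: linearZr_LR. Qed.

Lemma rdotDl x y z : rdot (x + y) z = rdot x z + rdot y z.
Proof. by rewrite /rdot hdotDl raddfD. Qed.

Lemma rdotBl x y z : rdot (x - y) z = rdot x z - rdot y z.
Proof. by rewrite /rdot hdotBl raddfB. Qed.

Lemma rdotZl r x z : rdot (rscale r x) z = r * rdot x z.
Proof.
by rewrite /rdot hdotZl; case: (hdot x z) => a b /=; rewrite mul0r subr0.
Qed.

Lemma rdotC x y : rdot x y = rdot y x.
Proof. by rewrite /rdot hdotC; case: (hdot y x). Qed.

Lemma rdotDr x y z : rdot z (x + y) = rdot z x + rdot z y.
Proof. by rewrite rdotC rdotDl !(rdotC z). Qed.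

Lemma rdotBr x y z : rdot z (x - y) = rdot z x - rdot z y.
Proof. by rewrite rdotC rdotBl !(rdotC z). Qed.

Lemma rdotZr r x z : rdot z (rscale r x) = r * rdot z x.
Proof. by rewrite rdotC rdotZl (rdotC z). Qed.

Lemma rdotxx x : rdot x x = nrm x ^+ 2.
Proof. by rewrite /rdot hdot_norm normE -rmorphXn. Qed.

(** Conjugate-linearity in the second argument turns ['i *: y] into the factor -i, and the real part
    of -i(a + ib) is b. *)
Lemma hdot_imag x y : complex.Im (hdot x y) = rdot x ('i *: y).
Proof.
by rewrite /rdot hdotZr conjCi -complexiE; case: (hdot x y) => a b /=; ring.
Qed.

(** Carries real identities back to the complex inner product: c = 1 recovers the real part and c =
    i the imaginary part. *)
Lemma hdot_eq x y z t : (forall c : R[i], rdot x (c *: y) = rdot z (c *: t)) ->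
  hdot x y = hdot z t.
Proof.
move=> e; apply/eqP; rewrite eq_complex !hdot_imag e eqxx andbT.
by have := e 1; rewrite !scale1r => /eqP.
Qed.

Lemma nrmD2 x y : nrm (x + y) ^+ 2 = nrm x ^+ 2 + 2 * rdot x y + nrm y ^+ 2.
Proof. by rewrite -!rdotxx rdotDl !rdotDr (rdotC y x); ring. Qed.

Lemma nrmB2 x y : nrm (x - y) ^+ 2 = nrm x ^+ 2 - 2 * rdot x y + nrm y ^+ 2.
Proof. by rewrite -!rdotxx rdotBl !rdotBr (rdotC y x); ring. Qed.

Lemma rdot_CS x y : rdot x y <= nrm x * nrm y.
Proof.
have [x0|x0] := eqVneq (nrm x) 0.
  by rewrite (nrm0_eq0 _ x0) nrm0 mul0r /rdot linear0l.
have [y0|y0] := eqVneq (nrm y) 0.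
  by rewrite (nrm0_eq0 _ y0) nrm0 mulr0 /rdot linear0r.
have xp : 0 < nrm x by rewrite lt_def x0 nrm_ge0.
have yp : 0 < nrm y by rewrite lt_def y0 nrm_ge0.
(* This square expands to 2 |x| |y| (|x| |y| - [rdot x y]). *)
have := sqr_ge0 (nrm (rscale (nrm y) x - rscale (nrm x) y)).
rewrite nrmB2 !nrmZ rdotZl rdotZr !gtr0_norm // => h.
have {}h : 0 <= 2 * (nrm x * nrm y) * (nrm x * nrm y - rdot x y) by nra.
by rewrite -subr_ge0; move: h; rewrite pmulr_rge0 // !mulr_gt0.
Qed.

Lemma rdot_CSN x y : - rdot x y <= nrm x * nrm y.
Proof.
have := rdot_CS (rscale (-1) x) y.
by rewrite rdotZl nrmZ normrN normr1 mul1r mulN1r.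
Qed.

Lemma rdot_normCS x y : `|rdot x y| <= nrm x * nrm y.
Proof. by rewrite ler_norml rdot_CS andbT lerNl rdot_CSN. Qed.

Lemma pos_realC (e : R[i]) : 0 < e -> exists2 r : R, 0 < r & e = r%:C.
Proof.
move=> e0; exists (complex.Re e); last by rewrite RRe_real // gtr0_real.
by move: e0; rewrite ltcE => /andP[].
Qed.

Lemma nbhs_nrmP x (B : set H) :
  nbhs x B <-> exists2 r : R, 0 < r & forall y, nrm (x - y) < r -> B y.
Proof.
rewrite -nbhs_ballE; split.
  move=> [e /= /pos_realC[r r0 ->] sB]; exists r => // y xy.
  by apply: sB; rewrite -ball_normE /= normE ltcR.
move=> [r r0 sB]; exists r%:C; first by rewrite /= ltcR.
by move=> y; rewrite -ball_normE /= normE ltcR; exact: sB.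
Qed.

Lemma closed_nrmP (M : set H) : closed M <->
  forall x, (forall e : R, 0 < e -> exists2 m, M m & nrm (x - m) < e) -> M x.
Proof.
split=> [clM x xM|clM x xM].
  apply: clM => B /nbhs_nrmP[r r0 rB].
  by have [m Mm xm] := xM _ r0; exists m; split => //; exact: rB.
apply: clM => e e0.
have [|m [Mm xm]] := xM [set y | nrm (x - y) < e].
  by apply/nbhs_nrmP; exists e.
by exists m.
Qed.

Lemma complete_nrm (u : nat -> H) :
  (forall e : R, 0 < e -> exists N, forall n m, (N <= n)%N -> (N <= m)%N ->
     nrm (u n - u m) < e) ->
  exists l, forall e : R, 0 < e -> exists N, forall n, (N <= n)%N ->
     nrm (l - u n) < e.
Proof.
move=> cu.
have : cauchy (u @ \oo).
  apply: cauchy_exP => e /= /pos_realC[r r0 ->].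
  have [N uN] := cu _ r0; exists (u N).
  exists N => // n /= Nn; rewrite -ball_normE /= normE ltcR.
  exact: uN.
move/cauchy_cvg/cvg_ex => [l ul]; exists l => e e0.
have : nbhs l [set y | nrm (l - y) < e] by apply/nbhs_nrmP; exists e.
by move=> /ul [N _ uN]; exists N => n /uN.
Qed.

End RealStructure.

Lemma invSn_lt {R : realType} (e : R) : 0 < e ->
  exists N, forall n, (N <= n)%N -> n.+1%:R^-1 < e.
Proof.
move=> e0; exists (Num.truncn e^-1) => n Nn.
rewrite invf_plt ?posrE //; apply: lt_le_trans (truncnS_gt _) _.
by rewrite ler_nat.
Qed.

(** * Nearest points in closed subspaces *)

Section HilbertGeometry.
Context {R : realType} {H : hilbertType R}.
Implicit Types (x y z : H) (r s : R) (M : set H).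

Definition linear_subspace M :=
  M 0 /\ forall (a : R[i]) x y, M x -> M y -> M (a *: x + y).

Lemma subspaceD M x y : linear_subspace M -> M x -> M y -> M (x + y).
Proof. by move=> [_ Ml] Mx My; have := Ml 1 _ _ Mx My; rewrite scale1r. Qed.

Lemma subspaceZ M (a : R[i]) x : linear_subspace M -> M x -> M (a *: x).
Proof. by move=> [M0 Ml] Mx; have := Ml a _ _ Mx M0; rewrite addr0. Qed.

Lemma subspaceB M x y : linear_subspace M -> M x -> M y -> M (x - y).
Proof.
move=> sM Mx My; apply: subspaceD => //; rewrite -scaleN1r.
exact: subspaceZ.
Qed.

(** A minimizing sequence is Cauchy by the parallelogram law, because midpoints stay in [M] and
    hence at distance at least [d] from [x]. *)
Lemma closest_point M x : linear_subspace M -> closed M ->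
  exists2 p, M p & forall m, M m -> nrm (x - p) <= nrm (x - m).
Proof.
move=> sM /closed_nrmP clM.
pose D := [set nrm (x - m) | m in M].
have lD : has_lbound D by exists 0 => _ [m _ <-]; exact: nrm_ge0.
have iD : has_inf D.
  by split => //; exists (nrm (x - 0)); exists 0; [exact: sM.1|].
pose d := inf D.
have dle m : M m -> d <= nrm (x - m).
  by move=> Mm; apply: ge_inf => //; exists m.
have d0 : 0 <= d.
  by apply: lb_le_inf; [exact: iD.1|move=> _ [m _ <-]; exact: nrm_ge0].
have /choice[u uP] : forall n, exists m, M m /\ nrm (x - m) < d + n.+1%:R^-1.
  move=> n; have [|_ [m Mm <-] ltm] := @inf_adherent _ D n.+1%:R^-1 _ iD.
    by rewrite invr_gt0.
  by exists m.
have [|p pu] := complete_nrm u.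
  move=> e e0.
  (* The parallelogram law will bound |u n - u m|^2 by 4(d + t)^2 - 4d^2 = 8dt + 4t^2. For t < 1
     this is at most (8d + 4)t, which the second term of the minimum keeps below e^2. *)
  have [|N NP] := @invSn_lt R (Num.min 1 (e ^+ 2 / (8 * d + 4))).
    by rewrite lt_min ltr01 divr_gt0 ?exprn_gt0 //; lra.
  exists N => n m Nn Nm.
  have /= := NP N (leqnn _); rewrite lt_min => /andP[].
  set t : R := N.+1%:R^-1 => t1; rewrite ltr_pdivlMr; last lra.
  move=> te.
  have tE k : (N <= k)%N -> nrm (x - u k) < d + t.
    move=> Nk; apply: lt_le_trans (uP k).2 _; rewrite lerD2l lef_pV2 ?posrE //.
    by rewrite ler_nat.
  have t0 : 0 < t by rewrite invr_gt0.
  have := dle (rscale 2^-1 (u n + u m))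
    (subspaceZ _ _ _ sM (subspaceD _ _ _ sM (uP n).1 (uP m).1)).
  have := nrmZ 2 (x - rscale 2^-1 (u n + u m)).
  have -> : rscale 2 (x - rscale 2^-1 (u n + u m)) = (x - u n) + (x - u m).
    rewrite /rscale scalerBr scalerA -rmorphM mulfV ?pnatr_eq0 //= scale1r.
    by rewrite rmorph_nat scaler_nat mulr2n opprD addrACA.
  rewrite ger0_norm // => e1 le1.
  have e2 := nrmD2 (x - u n) (x - u m).
  have e3 := nrmB2 (x - u n) (x - u m).
  have e4 : nrm (u n - u m) = nrm (x - u n - (x - u m)).
    by rewrite nrm_dist opprB [x - _ + _]addrC subrKA.
  have A0 := nrm_ge0 (x - u n); have B0 := nrm_ge0 (x - u m).
  have Ad := tE _ Nn; have Bd := tE _ Nm.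
  rewrite e4 -(ltr_pXn2r (n := 2)) ?nnegrE ?nrm_ge0 ?(ltW e0) //.
  rewrite e1 in e2.
  set A := nrm (x - u n) in e2 e3 A0 Ad *.
  set B := nrm (x - u m) in e2 e3 B0 Bd *.
  set C := nrm (x - _) in e1 e2 le1.
  have C2 : d ^+ 2 <= C ^+ 2 by rewrite ler_pXn2r ?nnegrE ?nrm_ge0.
  have A2 : A ^+ 2 <= (d + t) ^+ 2 by nra.
  have B2 : B ^+ 2 <= (d + t) ^+ 2 by nra.
  have t2 : t ^+ 2 <= t by rewrite expr2 ger_pMr ?ltW.
  rewrite exprMn in e2; rewrite sqrrD in A2 B2; rewrite mulrDr in te.
  by lra.
exists p; first apply: clM => e /pu[N NP].
  by exists (u N); [exact: (uP N).1|exact: NP].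
suff xpd e : 0 < e -> nrm (x - p) <= d + e.
  by move=> m /dle; apply: le_trans; apply/ler_addgt0Pr.
move=> e0.
have e2 : 0 < e / 2 by rewrite divr_gt0.
have [N NP] := pu _ e2; have [N' NP'] := invSn_lt _ e2.
have := NP _ (leq_maxl N N'); have := NP' _ (leq_maxr N N').
have := (uP (maxn N N')).2; set n := maxn _ _; set t := n.+1%:R^-1.
have := nrmD (x - u n) (u n - p); rewrite subrKA (nrm_dist (u n) p).
by lra.
Qed.

Lemma closest_orthogonal M x p : linear_subspace M -> M p ->
  (forall m, M m -> nrm (x - p) <= nrm (x - m)) ->
  forall m, M m -> hdot (x - p) m = 0.
Proof.
move=> sM Mp pP m Mm.
suff h k : M k -> rdot (x - p) k = 0.
  have -> : 0 = hdot (0 : H) 0 by rewrite linear0l.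
  by apply: hdot_eq => c; rewrite h ?{1}/rdot ?linear0l //; exact: subspaceZ.
move=> Mk.
pose r := rdot (x - p) k; pose n := nrm k ^+ 2.
have n0 : 0 <= n by exact: sqr_ge0.
(* The competitor is p + tk with t = r / (n + 1); the denominator n + 1 instead of n stays positive
   even for k = 0. Minimality then reads t^2 (n + 2) <= 0. *)
have := pP _ (subspaceD _ _ _ sM Mp
  (subspaceZ _ (real_complex R (r / (n + 1))) _ sM Mk)).
rewrite opprD addrA -(ler_pXn2r (n := 2)) ?nnegrE ?nrm_ge0 //.
rewrite -/(rscale _ k) (nrmB2 (x - p)) nrmZ rdotZr exprMn.
rewrite real_normK ?num_real // -/r -/n.
set a := nrm _ ^+ 2; set t := r / _ => h.
have rt : r = t * (n + 1) by rewrite /t divfK //; lra.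
have {}h : t ^+ 2 * (n + 2) <= 0 by rewrite rt in h; lra.
have t0 : t ^+ 2 <= 0 by move: h; rewrite pmulr_lle0 //; lra.
have : t = 0 by apply/eqP; rewrite -sqrf_eq0 eq_le t0 sqr_ge0.
by rewrite -/r rt => ->; rewrite mul0r.
Qed.

End HilbertGeometry.

(** * Uniform boundedness by a gliding hump *)

Section UniformBoundedness.
Context {R : realType} {H : hilbertType R}.
Implicit Types (x y z : H) (r s : R) (M : set H).

(* Sokal's gliding hump: each step moves by a third of the previous step along
   [m n], in the direction that does not decrease [|rdot _ (m n)|]. *)
Fixpoint hump (m : nat -> H) n : H :=
  if n is n'.+1 then
    hump m n' + rscale ((if 0 <= rdot (hump m n') (m n') then 1 else -1)
                        * 3^-1 ^+ n' / nrm (m n')) (m n')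
  else 0.

Lemma hump_step m n : 0 < nrm (m n) ->
  nrm (hump m n.+1 - hump m n) = 3^-1 ^+ n.
Proof.
move=> mn; rewrite /= addrAC subrr add0r nrmZ !normrM normfV (gtr0_norm mn).
rewrite divfK ?gt_eqF // (ger0_norm (x := _ ^+ _)) ?exprn_ge0 ?invr_ge0 //.
by case: ifP; rewrite ?normrN normr1 mul1r.
Qed.

(** The sign chosen in [hump] agrees with that of the previous value [c], so the absolute values of
    the two contributions add. *)
Lemma hump_dot m n : 0 < nrm (m n) ->
  3^-1 ^+ n * nrm (m n) <= `|rdot (hump m n.+1) (m n)|.
Proof.
move=> mn /=; rewrite rdotDl rdotZl rdotxx.
set c := rdot (hump m n) (m n); set t := 3^-1 ^+ n.
have t0 : 0 <= t by rewrite exprn_ge0 ?invr_ge0.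
have -> (s : R) : s * t / nrm (m n) * nrm (m n) ^+ 2 = s * t * nrm (m n).
  by rewrite expr2 mulrA divfK ?gt_eqF.
have tm : 0 <= t * nrm (m n) by rewrite mulr_ge0 // ltW.
case: ifP => [c0|/negbT c0]; first by rewrite ger0_norm; lra.
by rewrite -ltNge in c0; rewrite ltr0_norm; nra.
Qed.

(** The bound is the sum of 3^-j over n <= j < n + k in closed form; keeping the subtracted tail
    lets the induction close. *)
Lemma hump_dist m : (forall n, 0 < nrm (m n)) -> forall n k,
  nrm (hump m (n + k) - hump m n) <=
    3 / 2 * 3^-1 ^+ n - 3 / 2 * 3^-1 ^+ (n + k).
Proof.
move=> m0 n; elim=> [|k IH].
  by rewrite addn0 !subrr nrm0.
rewrite addnS -(subrKA (hump m (n + k))).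
apply: le_trans (nrmD _ _) _; rewrite hump_step // exprS.
set t := _ ^+ (n + k) in IH *.
have -> : 3 / 2 * (3^-1 * t) = 2^-1 * t by field.
by lra.
Qed.

Lemma pow3_small (e : R) : 0 < e ->
  exists N, forall n, (N <= n)%N -> 3 / 2 * 3^-1 ^+ n < e.
Proof.
move=> e0; have [|N NP] := @invSn_lt R (e / 2); first by rewrite divr_gt0.
exists N => n Nn; have := NP n Nn.
have : 3^-1 ^+ n <= n.+1%:R^-1 :> R.
  rewrite exprVn lef_pV2 ?posrE ?exprn_gt0 // -natrX ler_nat.
  by apply: ltn_expl.
set a := n.+1%:R^-1; set b := 3^-1 ^+ n; lra.
Qed.

(** If [Q] were unbounded, humps along a fast growing sequence in [Q] would converge to a point [l]
    at which the functionals given by that sequence are unbounded. *)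
Lemma uniform_boundedness (Q : set H) :
  (forall y, exists c : R, forall m, Q m -> `|rdot y m| <= c) ->
  exists C : R, forall m, Q m -> nrm m <= C.
Proof.
move=> Qb; apply: contrapT => nC.
(* The factor 3^n offsets the length of step n, the factor 2 offsets the half that later steps may
   cancel, and n + 1 provides the growth. *)
have /choice[m mP] (n : nat) : exists m, Q m /\ 3 ^+ n * n.+1%:R * 2 < nrm m.
  apply: contrapT => nm; apply: nC; exists (3 ^+ n * n.+1%:R * 2) => m Qm.
  by rewrite leNgt; apply/negP => lm; apply: nm; exists m.
have m0 n : 0 < nrm (m n).
  by apply: le_lt_trans (mP n).2; rewrite !mulr_ge0 ?exprn_ge0.
have hd := hump_dist _ m0.
have t0 n : 0 < 3^-1 ^+ n :> R by rewrite exprn_gt0 ?invr_gt0.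
have [|l lP] := complete_nrm (hump m).
  move=> e e0; have [|N NP] := pow3_small (e / 2); first by rewrite divr_gt0.
  have NP' := NP _ (leqnn N).
  have hN n : (N <= n)%N -> nrm (hump m n - hump m N) < e / 2.
    move=> Nn; have := hd N (n - N)%N; rewrite subnKC // => h.
    by have := t0 n; set a := _ ^+ n in h * => a0; lra.
  exists N => n k /hN hn /hN hk.
  have := nrmD (hump m n - hump m N) (hump m N - hump m k).
  by rewrite subrKA (nrm_dist (hump m N)); lra.
have [c cP] := Qb l.
pose n := Num.truncn c.
have := cP _ (mP n).1.
have nc : c < n.+1%:R by exact: truncnS_gt.
(* The steps after step n add up to at most 3^-n / 2, half of step n itself. Hence |rdot l (m n)| >=
   3^-n |m n| / 2 > n + 1 > c. *)
have ln : nrm (hump m n.+1 - l) <= 2^-1 * 3^-1 ^+ n.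
  suff ln e : 0 < e -> nrm (hump m n.+1 - l) <= 2^-1 * 3^-1 ^+ n + e.
    by apply/ler_addgt0Pr.
  move=> e0; have [N NP] := lP _ e0.
  have := NP _ (leq_addl n.+1 N); have := hd n.+1 N.
  have := nrmD (l - hump m (n.+1 + N)) (hump m (n.+1 + N) - hump m n.+1).
  rewrite subrKA (nrm_dist _ l).
  have := t0 (n.+1 + N)%N; set a := _ ^+ (n.+1 + N); rewrite exprS.
  set b := 3^-1 ^+ n; have -> : 3 / 2 * (3^-1 * b) = 2^-1 * b by field.
  by lra.
have := rdot_normCS (hump m n.+1 - l) (m n).
have := hump_dot m n (m0 n).
have := (mP n).2.
rewrite rdotBl.
set p := rdot (hump _ _) _; set q := rdot l _.
set t := 3^-1 ^+ n in ln *; set k : R := n.+1%:R in nc *; set b := nrm (m n).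
move=> kb tb pq qc.
have pq' : `|p| <= `|p - q| + `|q| by rewrite -{1}(subrK q p) ler_normD.
have tp : 0 < t := t0 n.
have bp : 0 < b := m0 n.
have lb : nrm (hump m n.+1 - l) * b <= 2^-1 * t * b by rewrite ler_wpM2r // ltW.
have : t * (3 ^+ n * k * 2) < t * b by rewrite ltr_pM2l.
have -> : t * (3 ^+ n * k * 2) = k * 2.
  by rewrite /t !mulrA -exprMn mulVf ?pnatr_eq0 // expr1n mul1r.
move: qc; rewrite -/q; lra.
Qed.

End UniformBoundedness.

(** * Bounded operators and the projection theorem *)

Section Operators.
Context {R : realType} {H : hilbertType R}.
Implicit Types (x y z : H) (r s : R) (M : set H) (A B P : H -> H).

Lemma linear_boundP A : linear A ->
  continuous A <-> exists2 K : R, 0 < K & forall x, nrm (A x) <= K * nrm x.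
Proof.
move=> lA.
pose A' : {linear H -> H} := HB.pack A (GRing.isLinear.Build _ _ _ _ _ lA).
have <- : bounded_near A (nbhs 0) <-> continuous A.
  exact: (linear_bounded_continuous A').
have -> : bounded_near A (nbhs 0) <->
    \forall r \near +oo, forall x, `|A x| <= r * `|x|.
  exact: (linear_boundedP A').
split.
  move=> /pinfty_ex_gt0 [_ /pos_realC [K K0 ->] KA].
  by exists K => // x; rewrite -lecR rmorphM /= -!normE.
move=> [K K0 KA]; exists (real_complex R K); split.
  by rewrite gtr0_real // ltcR.
move=> r Kr x; apply: (@le_trans _ _ (real_complex R K * `|x|)).
  by rewrite !normE -rmorphM lecR.
by rewrite ler_wpM2r // ltW.
Qed.

Lemma bounded_opP A : bounded_op A <->
  linear A /\ exists2 K : R, 0 < K & forall x, nrm (A x) <= K * nrm x.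
Proof.
by split=> -[lA]; [move/(linear_boundP A lA)|move/(linear_boundP A lA)].
Qed.

Lemma opD A x y : bounded_op A -> A (x + y) = A x + A y.
Proof. by move=> [lA _]; have := lA 1 x y; rewrite !scale1r. Qed.

Lemma op0 A : bounded_op A -> A 0 = 0.
Proof. by move=> bA; apply: (addrI (A 0)); rewrite -opD // !addr0. Qed.

Lemma opZ A (a : R[i]) x : bounded_op A -> A (a *: x) = a *: A x.
Proof. by move=> bA; rewrite -[a *: x]addr0 bA.1 op0 // addr0. Qed.

Lemma opB A x y : bounded_op A -> A (x - y) = A x - A y.
Proof. by move=> bA; rewrite opD // -scaleN1r opZ // scaleN1r. Qed.

Lemma bounded_op_comp A B : bounded_op A -> bounded_op B -> bounded_op (A \o B).
Proof.
move=> [lA cA] [lB cB]; split; first by move=> a x y /=; rewrite lB lA.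
by move=> x; apply: continuous_comp; [exact: cB|exact: cA].
Qed.

Lemma bounded_op_sub A B : bounded_op A -> bounded_op B -> bounded_op (A - B).
Proof.
move=> [lA cA] [lB cB]; split; last first.
  by move=> x; apply: continuousB; [exact: cA|exact: cB].
by move=> a x y; rewrite !fctE lA lB scalerBr opprD addrACA.
Qed.

Lemma bounded_op_id : bounded_op (id : H -> H).
Proof. by split=> // x. Qed.

Lemma range_subspace A : bounded_op A -> linear_subspace (range A).
Proof.
move=> bA; split; first by rewrite -(op0 _ bA); exact: imageP.
by move=> a _ _ [x _ <-] [y _ <-]; rewrite -bA.1; exact: imageP.
Qed.

Lemma hdot_eq0 x : hdot x x = 0 -> x = 0.
Proof. by move=> /eqP; rewrite dnorm_eq0 => /eqP. Qed.

Lemma selfadjoint_rdot A : selfadjoint A ->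
  forall x y, rdot (A x) y = rdot x (A y).
Proof. by move=> sA x y; rewrite /rdot sA. Qed.

Lemma projP P M : orthogonal_projection P -> range P = M ->
  (forall x, M (P x)) /\ (forall x, M x -> P x = x).
Proof.
move=> [bP PP _] <-; split=> [x|_ [x _ <-]]; first by exists x.
exact: (congr1 (@^~ x) PP).
Qed.

(** [P x] is the nearest point of [M]. It is the only p in [M] with x - p orthogonal to [M], and
    this uniqueness yields linearity and idempotence. *)
Lemma projection_theorem M : linear_subspace M -> closed M ->
  exists P, orthogonal_projection P /\ range P = M.
Proof.
move=> sM clM.
have /choice[P PP] x : exists p, M p /\ forall m, M m -> hdot (x - p) m = 0.
  have [p Mp pmin] := closest_point _ x sM clM.
  by exists p; split=> //; exact: closest_orthogonal.
have uniq x p : M p -> (forall m, M m -> hdot (x - p) m = 0) -> P x = p.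
  move=> Mp px; have MPp : M (P x - p).
    by apply: subspaceB => //; exact: (PP x).1.
  apply/subr0_eq/hdot_eq0.
  (* An element of [M] is written as a difference of two vectors orthogonal to [M], so it is
     orthogonal to itself. *)
  have {1}-> : P x - p = (x - p) - (x - P x) by rewrite opprB [RHS]addrC subrKA.
  by rewrite hdotBl px // (PP x).2 // subrr.
have PM x : M x -> P x = x.
  by move=> Mx; apply: uniq => // m _; rewrite subrr linear0l.
have lP : linear P.
  move=> a x y; apply: uniq; first exact: sM.2 (PP x).1 (PP y).1.
  move=> m Mm; rewrite opprD addrACA -scalerBr hdotDl hdotZl.
  by rewrite (PP x).2 // (PP y).2 // mulr0 addr0.
have sP : selfadjoint P.
  move=> x y; have := (PP x).2 _ (PP y).1; rewrite hdotBl => /subr0_eq ->.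
  have := (PP y).2 _ (PP x).1; rewrite hdotBl => /subr0_eq h.
  by rewrite hdotC h -hdotC.
exists P; split; last first.
  apply/seteqP; split=> [_ [x _ <-]|x Mx]; first exact: (PP x).1.
  by exists x => //; exact: PM.
split=> //; last by apply/funext => x /=; apply: PM; exact: (PP x).1.
apply/bounded_opP; split=> //; exists 1 => // x; rewrite mul1r.
have [->|] := eqVneq (nrm (P x)) 0; first exact: nrm_ge0.
move=> Px0; have Pxp : 0 < nrm (P x) by rewrite lt_def Px0 nrm_ge0.
(* Contractivity is |P x|^2 = [rdot x (P x)] <= |x| |P x|, divided by |P x|. *)
rewrite -(ler_pM2r Pxp) -expr2 -rdotxx.
rewrite (selfadjoint_rdot _ sP) PM; [exact: rdot_CS|exact: (PP x).1].
Qed.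

(** The projection theorem makes the set of candidates nonempty, so [xget] does not return its
    default 0. *)
Lemma proj_ontoP M : linear_subspace M -> closed M ->
  orthogonal_projection (proj_onto M) /\ range (proj_onto M) = M.
Proof.
move=> sM clM; have [P PM] := projection_theorem _ sM clM.
exact: (@xgetPex _ 0 [set P | orthogonal_projection P /\ range P = M]
  (ex_intro _ P PM)).
Qed.

End Operators.

(** * Operators bounded below, and positive operators *)

Section PositiveOperators.
Context {R : realType} {H : hilbertType R}.
Implicit Types (x y z : H) (r s : R) (M : set H) (A B P : H -> H).

Lemma eps_small_eq x y (K : R) : 0 <= K ->
  (forall e : R, 0 < e -> nrm (x - y) <= K * e) -> x = y.
Proof.
move=> K0 xy; apply/subr0_eq/nrm0_eq0/eqP; rewrite eq_le nrm_ge0 andbT leNgt.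
apply/negP => n0.
have e0 : 0 < nrm (x - y) / (2 * (K + 1)) by rewrite divr_gt0 //; lra.
have := xy _ e0; set t := _ / _ in e0 *.
have -> : nrm (x - y) = t * (2 * (K + 1)) by rewrite /t divfK //; lra.
by nra.
Qed.

(** A fixed point m within e of y gives |A y - y| <= |A (y - m)| + |m - y| <= (K + 1)e. The
    closedness of [range T] will come from here. *)
Lemma closed_fixpoints A : bounded_op A -> closed [set y | A y = y].
Proof.
move=> bA; have /bounded_opP[_ [K K0 KA]] := bA.
apply/closed_nrmP => y yP; apply: (@eps_small_eq _ _ (K + 1)); first lra.
move=> e /yP[m Am ym].
have := nrmD (A y - m) (m - y); rewrite subrKA (nrm_dist m).
have := KA (y - m); rewrite opB // Am.
by nra.
Qed.

Lemma bounded_below_inj A (c : R) : bounded_op A -> 0 < c ->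
  (forall x, c * nrm x <= nrm (A x)) -> injective A.
Proof.
move=> bA c0 cA x y Axy; apply/subr0_eq/nrm0_eq0.
have := cA (x - y); rewrite opB // Axy subrr nrm0 pmulr_rle0 // => h.
by apply/eqP; rewrite eq_le h nrm_ge0.
Qed.

(** The lower bound makes preimages of a convergent sequence of values Cauchy; [A] sends their limit
    to the limit of the values. *)
Lemma bounded_below_closed_range A (c : R) : bounded_op A -> 0 < c ->
  (forall x, c * nrm x <= nrm (A x)) -> closed (range A).
Proof.
move=> bA c0 cA; have /bounded_opP[_ [K K0 KA]] := bA.
apply/closed_nrmP => y yP.
have /choice[u uP] (n : nat) : exists x, nrm (y - A x) < n.+1%:R^-1.
  by have [|_ [x _ <-] xn] := yP n.+1%:R^-1; [rewrite invr_gt0|exists x].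
have uN (e : R) : 0 < e ->
    exists N, forall n, (N <= n)%N -> nrm (y - A (u n)) < e.
  move=> /invSn_lt[N NP]; exists N => n Nn.
  exact: lt_trans (uP n) (NP n Nn).
have [|l lP] := complete_nrm u.
  move=> e e0; have [|N NP] := uN (c * e / 2).
    by rewrite divr_gt0 // mulr_gt0.
  exists N => n m /NP hn /NP hm; rewrite -(ltr_pM2l c0).
  apply: le_lt_trans (cA _) _; rewrite opB //.
  have := nrmD (A (u n) - y) (y - A (u m)).
  by rewrite subrKA (nrm_dist _ y); lra.
suff <- : A l = y by exact: imageP.
apply: (@eps_small_eq _ _ (K + 1)); first lra.
move=> e e0; have [N NP] := uN _ e0; have [N' NP'] := lP _ e0.
have := NP _ (leq_maxl N N'); have := NP' _ (leq_maxr N N').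
set n := maxn N N'.
have := KA (l - u n); rewrite opB //.
have := nrmD (A l - A (u n)) (A (u n) - y); rewrite subrKA (nrm_dist _ y).
by nra.
Qed.

(** The range is closed, and its orthogonal complement is the kernel of the self-adjoint [A], which
    is trivial; so [A] is onto. *)
Lemma selfadjoint_bounded_below_inverse A (c : R) :
  bounded_op A -> selfadjoint A -> 0 < c ->
  (forall x, c * nrm x <= nrm (A x)) ->
  exists D, [/\ bounded_op D, A \o D = id & D \o A = id].
Proof.
move=> bA sA c0 cA; have injA := bounded_below_inj _ _ bA c0 cA.
have sr := range_subspace _ bA.
have clr := bounded_below_closed_range _ _ bA c0 cA.
have /choice[D AD] y : exists x, A x = y.
  have [_ [x _ <-] pmin] := closest_point _ y sr clr.
  have pP := closest_orthogonal _ _ _ sr (imageP A I) pmin.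
  (* The residual v = y - A x is orthogonal to the range, so <A v, A v> = <v, A (A v)> = 0, and
     injectivity gives v = 0. *)
  exists x; apply/esym/subr0_eq/injA; rewrite (op0 _ bA).
  by apply: hdot_eq0; rewrite sA pP //; exact: imageP.
exists D; split; [|exact/funext|apply/funext => x; apply: injA; exact: AD].
apply/bounded_opP; split; first by move=> a x y; apply: injA; rewrite bA.1 !AD.
exists c^-1; first by rewrite invr_gt0.
by move=> x; rewrite ler_pdivlMl // -{2}(AD x).
Qed.

Lemma positive_op_rdot A x : positive_op A -> 0 <= rdot (A x) x.
Proof. by move=> [_ _ pA]; have := pA x; rewrite lecE => /andP[]. Qed.

(* Positivity of [A] at [x - K^-1 * A x]. *)
Lemma positive_op_nrm2 A (K : R) : positive_op A -> 0 < K ->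
  (forall x, nrm (A x) <= K * nrm x) ->
  forall x, nrm (A x) ^+ 2 <= K * rdot (A x) x.
Proof.
move=> pA K0 KA x; have [bA sA _] := pA.
have := positive_op_rdot _ (x - rscale K^-1 (A x)) pA.
rewrite opB // /rscale opZ // -!/(rscale _ _).
rewrite rdotBl !rdotBr !rdotZl !rdotZr (selfadjoint_rdot _ sA (A x) x) rdotxx.
have := rdot_CS (A (A x)) (A x); have := KA (A x); have := nrm_ge0 (A x).
set n := nrm (A x); set q := rdot (A x) x; set w := rdot (A (A x)) _.
set k := nrm (A (A x)) => n0 kn wk.
have wn : w <= K * n ^+ 2 by nra.
have kw : K^-1 * (K^-1 * w) <= K^-1 * n ^+ 2.
  by rewrite ler_pM2l ?invr_gt0 // ler_pdivrMl.
move=> h; rewrite -ler_pdivrMl //; lra.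
Qed.

End PositiveOperators.

(** * Inverting the compression of [A] to the range of [P] *)

Section Compression.
Context {R : realType} {H : hilbertType R}.
Variables (P A : H -> H).
Hypotheses (oP : orthogonal_projection P) (pA : positive_op A).
Hypothesis rPA : range (P \o A) = range P.

Let bP : bounded_op P. Proof. by case: oP. Qed.
Let sP : selfadjoint P. Proof. by case: oP. Qed.
Let PP x : P (P x) = P x. Proof. by case: oP => _ /(congr1 (@^~ x)). Qed.
Let bA : bounded_op A. Proof. by case: pA. Qed.
Let sA : selfadjoint A. Proof. by case: pA. Qed.

(* [A = (P A)^*] on [range P], and [P A] is onto [range P]; so the unit ball of
   [m |-> nrm (A m)] in [range P] is weakly bounded. *)
Lemma bounded_below_on_range :
  exists2 C : R, 0 < C & forall x, nrm (P x) <= C * nrm (A (P x)).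
Proof.
have [|C CP] := @uniform_boundedness R H [set m | P m = m /\ nrm (A m) <= 1].
  move=> y; have [x _ xy] : range (P \o A) (P y) by rewrite rPA; exact: imageP.
  exists (nrm x) => m [Pm Am].
  rewrite -Pm -(selfadjoint_rdot _ sP) -xy /= (selfadjoint_rdot _ sP) !Pm.
  rewrite (selfadjoint_rdot _ sA); apply: le_trans (rdot_normCS _ _) _.
  by rewrite ler_piMr ?nrm_ge0.
have C0 : 0 <= C.
  by rewrite -(@nrm0 R H); apply: CP; rewrite /= !op0 // nrm0.
exists (2 * C + 1); first lra.
move=> x; have a0 := nrm_ge0 (A (P x)); set a := nrm (A (P x)) in a0 *.
have [->|] := eqVneq (nrm (P x)) 0; first by rewrite mulr_ge0 //; lra.
move=> n0; have np : 0 < nrm (P x) by rewrite lt_def n0 nrm_ge0.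
set n := nrm (P x) in n0 np *.
(* Rescaling by a + e avoids dividing by a, not yet known to be nonzero. It gives n <= C(a + e) with
   Ce <= n / 2, hence n <= 2Ca. *)
pose e := n / (2 * (C + 1)).
have ne : n = e * (2 * (C + 1)) by rewrite /e divfK //; lra.
have e0 : 0 < e by rewrite divr_gt0 //; lra.
have ae : 0 < a + e by lra.
have : nrm (rscale (a + e)^-1 (P x)) <= C.
  apply: CP; split; first by rewrite /rscale opZ // PP.
  rewrite /rscale opZ // -/(rscale _ _) nrmZ gtr0_norm ?invr_gt0 //.
  by rewrite ler_pdivrMl // mulr1 -/a; lra.
rewrite nrmZ gtr0_norm ?invr_gt0 // ler_pdivrMl // -/n.
by rewrite ne; nra.
Qed.

(** The compression is completed by the identity on the orthogonal complement of [range P], so that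
    it can be inverted on all of [H]. *)
Let B := P \o A \o P - (P - id).

Let BE x : B x = P (A (P x)) + (x - P x).
Proof. by rewrite /B !fctE opprB. Qed.

Let bB : bounded_op B.
Proof.
apply: bounded_op_sub; first by do 2 apply: bounded_op_comp => //.
by apply: bounded_op_sub => //; exact: bounded_op_id.
Qed.

Let sB : selfadjoint B.
Proof.
by move=> x y; rewrite !BE hdotDl hdotDr hdotBl hdotBr sP sA sP sP.
Qed.

Let hdotBx x : hdot (B x) x = hdot (A (P x)) (P x) + hdot (x - P x) (x - P x).
Proof.
rewrite BE hdotDl sP; congr (_ + _).
by rewrite hdotBr -(sP (x - P x)) opB // PP subrr linear0l subr0.
Qed.

(** [D] is the inverse of [B], and inherits symmetry and positivity through <D x, x> = <B (D x), D
    x>. *)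
Lemma compression_inverse : exists D, [/\ bounded_op D,
  forall x y, hdot (D x) y = hdot x (D y), forall x, 0 <= hdot (D x) x &
  forall x, P (A (P (D (P x)))) = P x].
Proof.
have [C C0 CP] := bounded_below_on_range.
have /bounded_opP[_ [K K0 KA]] := bA.
have q2 x : nrm (A x) ^+ 2 <= K * rdot (A x) x :=
  positive_op_nrm2 _ _ pA K0 KA x.
(* |P x|^2 <= C^2 |A (P x)|^2 <= C^2 K <A (P x), P x>. Adding |x - P x|^2, Pythagoras yields |x|^2
   <= (1 + k) <B x, x>. *)
pose k := C ^+ 2 * K.
have k0 : 0 < k by rewrite mulr_gt0 // exprn_gt0.
pose c := (1 + k)^-1.
have c0 : 0 < c by rewrite invr_gt0; lra.
have [x|D [bD BD DB]] := @selfadjoint_bounded_below_inverse R H B c bB sB c0.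
  have [->|] := eqVneq (nrm x) 0; first by rewrite mulr0 nrm_ge0.
  move=> n0; have np : 0 < nrm x by rewrite lt_def n0 nrm_ge0.
  rewrite -(ler_pM2r np); apply: le_trans (rdot_CS _ _).
  rewrite /rdot hdotBx raddfD /= -!/(rdot _ _) rdotxx.
  have Px : nrm (P x) ^+ 2 <= k * rdot (A (P x)) (P x).
    have := CP x; have := q2 (P x); have := nrm_ge0 (P x); rewrite /k.
    set u := nrm (P x); set v := nrm (A (P x)); set w := rdot _ _ => u0 vw uv.
    have : u ^+ 2 <= (C * v) ^+ 2 by nra.
    have : C ^+ 2 * v ^+ 2 <= C ^+ 2 * (K * w) by rewrite ler_pM2l ?exprn_gt0.
    by rewrite exprMn; lra.
  have x2 : nrm x ^+ 2 = nrm (P x) ^+ 2 + nrm (x - P x) ^+ 2.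
    rewrite nrmB2 -(rdotxx (P x)) (selfadjoint_rdot _ sP) PP; lra.
  rewrite -mulrA -expr2 /c ler_pdivrMl; last lra.
  have := positive_op_rdot _ (P x) pA; have := sqr_ge0 (nrm (x - P x)).
  by rewrite x2; nra.
have BDx x : B (D x) = x by exact: (congr1 (@^~ x) BD).
have sD x y : hdot (D x) y = hdot x (D y).
  by rewrite -{1}(BDx y) -sB BDx.
exists D; split=> // x.
  rewrite -{2}(BDx x) -sB hdotBx addr_ge0 //.
  by case: pA => _ _; apply.
(* Applying [P] to B (D (P x)) = P x removes the component in the complement. *)
have := BDx (P x); rewrite BE => e.
by have := congr1 P e; rewrite opD // opB // !PP subrr addr0.
Qed.

(* [X] is the Moore-Penrose inverse of [P] restricted to the range of
   [X \o P \o A]. *)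
Lemma positive_lift : exists X, [/\ bounded_op X, forall x, X (P x) = X x,
  forall x, P (X x) = P x & positive_op (X \o P \o A)].
Proof.
have [D [bD sD pD PD]] := compression_inverse.
exists (A \o P \o D \o P); split=> [|x|x|].
- by do 3 apply: bounded_op_comp => //.
- by rewrite /= PP.
- exact: PD.
split; first by do 5 apply: bounded_op_comp => //.
  by move=> x y; rewrite /= !PP sA sP sD sP sA.
move=> x.
by rewrite /= PP sA sP.
Qed.

End Compression.

(** * Kernels, orthogonal projections and Moore-Penrose inverses *)

Section MoorePenrose.
Context {R : realType} {H : hilbertType R}.
Implicit Types (A B E P U V W X : H -> H).

Lemma projection_ker_eq0 P x : orthogonal_projection P ->
  (forall y, hdot x (P y) = 0) -> P x = 0.
Proof. by move=> [_ _ sP] xP; apply: hdot_eq0; rewrite sP. Qed.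

(** Both operators are self-adjoint, so each kernel is the orthogonal complement of the common
    range. *)
Lemma ker_projection_range A P : selfadjoint A -> orthogonal_projection P ->
  range P = range A -> ker P = ker A.
Proof.
move=> sA oP PA; have [_ _ sP] := oP; have [PM fixP] := projP _ _ oP PA.
apply/seteqP; split=> x; rewrite /ker /= => x0.
  apply: hdot_eq0; rewrite sA -(fixP (A (A x))); last exact: imageP.
  by rewrite -sP x0 linear0l.
apply: projection_ker_eq0 => // y; have [z _ <-] := PM y.
by rewrite -sA x0 linear0l.
Qed.

(** Since x - E x lies in ker E = ker W, WE = W; likewise EW = E. Taking adjoints in the latter
    gives WE = E, so E = W. *)
Lemma selfadjoint_idempotent_eq E W : bounded_op E -> bounded_op W ->
  selfadjoint E -> selfadjoint W ->
  (forall x, E (E x) = E x) -> (forall x, W (W x) = W x) ->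
  ker E = ker W -> E = W.
Proof.
move=> bE bW sE sW EE WW kEW.
have WE x : W (E x) = W x.
  apply/esym/subr0_eq; rewrite -opB //.
  have : ker E (x - E x) by rewrite /ker /= opB // EE subrr.
  by rewrite kEW.
have EW x : E (W x) = E x.
  apply/esym/subr0_eq; rewrite -opB //.
  have : ker W (x - W x) by rewrite /ker /= opB // WW subrr.
  by rewrite -kEW.
apply/funext => x; apply/subr0_eq/hdot_eq0; set v := _ - _.
by rewrite {1}/v hdotBl -(EW x) sE sW WE -sW subrr.
Qed.

(** U^+ U is a self-adjoint idempotent with the kernel of [U], hence equals [W]. The witness [X]
    ensures that [MP_inverse U] satisfies the Penrose equations. *)
Lemma MP_inverse_compl U X W : bounded_op U -> is_MP_inverse U X ->
  orthogonal_projection W -> ker W = ker U -> MP_inverse U \o U = W.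
Proof.
move=> bU UX [bW WW sW] kWU.
have [bY [UYU YUY _ sYU]] : is_MP_inverse U (MP_inverse U).
  exact: (@xgetPex _ 0 (is_MP_inverse U) (ex_intro _ X UX)).
have UYUx x : U (MP_inverse U (U x)) = U x by exact: (congr1 (@^~ x) UYU).
apply: selfadjoint_idempotent_eq => //.
- exact: bounded_op_comp.
- by move=> x /=; rewrite UYUx.
- by move=> x; exact: (congr1 (@^~ x) WW).
rewrite kWU; apply/seteqP; split=> x; rewrite /ker /= => x0;
  last by rewrite x0 op0.
by rewrite -UYUx x0 op0.
Qed.

Lemma projection_MP_inverse P : orthogonal_projection P -> is_MP_inverse P P.
Proof.
by move=> [bP PP sP]; split=> //; split; rewrite ?PP // => x y; rewrite sP.
Qed.

End MoorePenrose.

(** * Construction of [T] and comparison of the two iteration operators *)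

Theorem corollary6p9 (R : realType) (H : hilbertType R) (S : H -> H)
    (S_PLplus : in_PLplus S) (S_closed : closed (range S)) :
  let P_S := proj_onto (range S) in
  exists T : H -> H,
    [/\ positive_op T, closed (range T), ker T = ker S & S = P_S \o T] /\
    let P_T := proj_onto (range T) in
    let V := P_T - T in
    [/\ proper_splitting T P_T V,
        proper_splitting S (P_S \o P_T) (P_S \o V) &
        convergent_splitting P_T V <->
        convergent_splitting (P_S \o P_T) (P_S \o V)].
Proof.
move=> P; case: S_PLplus => P0 [A [oP0 pA SE]].
have bA : bounded_op A by case: pA.
have bS : bounded_op S by rewrite SE; apply: bounded_op_comp => //; case: oP0.
have [oP rP] : orthogonal_projection P /\ range P = range S.
  by apply: proj_ontoP => //; exact: range_subspace.
have [bP _ sP] := oP.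
have [PS fixP] := projP _ _ oP rP.
have [_ fixP0] := projP _ _ oP0 (erefl (range P0)).
have PSE x : P (S x) = S x by apply: fixP; exact: imageP.
(* The given projection [P0] may be replaced by [P]: [range S] lies in [range P0], so A x - S x = A
   x - P0 (A x) is orthogonal to [range S]. *)
have SPA : S = P \o A.
  apply/funext => x /=; apply/esym/subr0_eq; rewrite -PSE -opB //.
  apply: projection_ker_eq0 => // y; have [z _ <-] := PS y.
  have P0S : P0 (S z) = S z by rewrite SE; apply: fixP0; exact: imageP.
  rewrite hdotBl -{1}P0S; have [_ _ <-] := oP0.
  by rewrite SE /= subrr.
have rPA : range (P \o A) = range P by rewrite -SPA rP.
have [X [bX XP PX pT]] := positive_lift _ _ oP pA rPA.
pose T := X \o S.
have {}pT : positive_op T.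
  by move: pT; rewrite /T SPA.
have [bT sT _] := pT.
have PT x : P (T x) = S x by rewrite /T /= PX PSE.
have kT : ker T = ker S.
  apply/seteqP; split=> x; rewrite /ker /= => x0; last by rewrite /T /= x0 op0.
  by rewrite -PT x0 op0.
(* [X \o P] is idempotent with range [range T]; a range described by fixed points is closed. *)
have rT : range T = [set y | (X \o P) y = y].
  apply/seteqP; split=> [_ [x _ <-]|y /= <-]; first by rewrite /= PT.
  by have [z _ <-] := PS y; exact: (imageP T).
have clT : closed (range T).
  by rewrite rT; apply: closed_fixpoints; exact: bounded_op_comp.
have XT x : range T (X x).
  by rewrite -XP; have [z _ <-] := PS x; exact: (imageP T).
exists T; split; first by split=> //; apply/funext => x; rewrite /= PT.
move=> Q V.
have [oQ rQ] : orthogonal_projection Q /\ range Q = range T.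
  by apply: proj_ontoP => //; exact: range_subspace.
have [bQ QQ sQ] := oQ; have [QT fixQ] := projP _ _ oQ rQ.
have QX x : Q (X x) = X x by apply: fixQ.
(* [X] inverts [P] on [range T]; in particular [P] is injective there, which gives the kernel of
   [P \o Q] below. *)
have XPQ x : X (P (Q x)) = Q x.
  by have [z _ <-] := QT x; rewrite PT.
have bV : bounded_op V by exact: bounded_op_sub.
have QV : Q \o V = V.
  apply/funext => x.
  by rewrite /= /V !fctE opB // (fixQ _ (QT x)) (fixQ (T x)) //.
have kQ : ker Q = ker T by exact: ker_projection_range.
have bU : bounded_op (P \o Q) by exact: bounded_op_comp.
have kU : ker (P \o Q) = ker Q.
  apply/seteqP; split=> x; rewrite /ker /= => x0; last by rewrite x0 op0.
  by rewrite -XPQ x0 op0.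
(* The two products are [P \o Q \o X = P] and [X \o P \o Q = Q], both orthogonal projections. *)
have UX : is_MP_inverse (P \o Q) X.
  split=> //; split.
  - by apply/funext => x; rewrite /= QX XPQ.
  - by apply/funext => x; rewrite /= XPQ QX.
  - by move=> x y; rewrite /= !QX !PX sP.
  - by move=> x y; rewrite /= !XPQ sQ.
split.
- by split=> //; rewrite /V subKr.
- split=> //.
  + exact: bounded_op_comp.
  + by apply/funext => x; rewrite !fctE /= /V !fctE opB // subKr PT.
  + apply/seteqP; split=> [_ [x _ <-]|_ [x _ <-]].
      by rewrite /=; exact: PS.
    by rewrite -PT -(fixQ (T x)); [exact: (imageP (P \o Q))|exact: imageP].
  + by rewrite kU kQ kT.
rewrite /convergent_splitting.
(* Both iteration operators reduce to [V], since [V] has values in [range T] and both Q^+ Q and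
   (PQ)^+ PQ equal [Q]. *)
have -> : MP_inverse Q \o V = V.
  rewrite -{1}QV compA.
  by rewrite (MP_inverse_compl _ _ _ bQ (projection_MP_inverse _ oQ) oQ).
have -> : MP_inverse (P \o Q) \o (P \o V) = V.
  by rewrite -{1}QV (compA P) compA (MP_inverse_compl _ _ _ bU UX oQ).
by [].
Qed.
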